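(* There is an absolute constant $c>0$ and an integer $n_0$ such that the following holds. Consider the equal-neighbor, time-invariant, bidirectional agreement iteration $x(t+1)=Ax(t)$ on a bidirectional spanning tree with $n\ge2$ nodes. Then its convergence rate satisfies $$\rho\ \le\ 1-\frac{1}{3n^2},$$ and its convergence time satisfies $T_n(\epsilon)=O\big(n^2\log(n/\epsilon)\big)$, i.e. $T_n(\epsilon)\le c\,n^2\log(n/\epsilon)$ for all $n\ge n_0$ and all $\epsilon\in(0,1)$.
   Context: A bidirectional spanning tree on $\mathcal N=\{1,\ldots,n\}$ is a directed graph $(\mathcal N,\mathcal E)$ that is symmetric ($(i,j)\in\mathcal E$ iff $(j,i)\in\mathcal E$), contains all self-arcs $(i,i)$, and becomes a tree spanning $\mathcal N$ after deleting self-arcs, ignoring orientations and removing duplicate arcs. Let $\mathcal N_i=\{j:(j,i)\in\mathcal E\}$ (including $i$) and $d_i=|\mathcal N_i|$. The equal-neighbor, time-invariant, bidirectional model is the iteration $x(t+1)=Ax(t)$ with $a_{ij}=1/d_i$ if $j\in\mathcal N_i$ and $a_{ij}=0$ otherwise. For every $x(0)$, $x(t)$ converges to a limit $x^*$ in $X=\{c\mathbf 1:c\in\mathbb R\}$, where $\mathbf 1$ is the all-ones vector. The convergence rate and convergence time are $$\rho=\sup_{x(0)\notin X}\lim_{t\to\infty}\Big(\frac{\|x(t)-x^*\|_2}{\|x(0)-x^*\|_2}\Big)^{1/t},$$ $$T_n(\epsilon)=\min\Big\{\tau:\ \frac{\|x(t)-x^*\|_\infty}{\|x(0)-x^*\|_\infty}\le\epsilon\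 \ \forall\,t\ge\tau,\ \forall\,x(0)\notin X\Big\}.$$ $\log$ is the base-2 logarithm. *)

(* Defs.v *)
From mathcomp Require Import all_boot all_order all_algebra.
From mathcomp Require Import all_classical all_reals all_analysis.

Set Implicit Arguments.
Unset Strict Implicit.
Unset Printing Implicit Defensive.

Import Order.TTheory GRing.Theory Num.Theory.
Import numFieldNormedType.Exports.

Local Open Scope classical_set_scope.
Local Open Scope ring_scope.

(* A directed graph on {1, ..., n} is a relation [e] on ['I_n]; [e j i] means
   that (j, i) is an arc. *)

Definition del_self_arcs (n : nat) (e : rel 'I_n) : rel 'I_n :=
  [rel i j | (i != j) && e i j].

(* [adj] is meant to be symmetric and irreflexive: then [:: i; j] is a cycle of
   the relation as soon as i and j are adjacent, but it runs twice through the
   same undirected edge, so only the simple cycles with at least three vertices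
   are graph cycles. *)
Definition undirected_tree (n : nat) (adj : rel 'I_n) : Prop :=
  (forall i j, connect adj i j) /\
  (forall s : seq 'I_n, ucycle adj s -> (size s < 3)%N).

Definition bidirectional_spanning_tree (n : nat) (e : rel 'I_n) : Prop :=
  [/\ symmetric e, reflexive e & undirected_tree (del_self_arcs e)].

Definition neighbors (n : nat) (e : rel 'I_n) (i : 'I_n) : {set 'I_n} :=
  [set j | e j i]%SET.

Definition equal_neighbor_mx (R : realType) (n : nat) (e : rel 'I_n) : 'M[R]_n :=
  \matrix_(i, j)
    if j \in neighbors e i then #|neighbors e i|%:R^-1 else 0.

Definition trajectory (R : realType) (n : nat) (A : 'M[R]_n) (x0 : 'cV[R]_n)
    (t : nat) : 'cV[R]_n :=
  iter t (fun x => A *m x) x0.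

Definition consensus (R : realType) (n : nat) : set 'cV[R]_n :=
  [set x | exists c : R, x = const_mx c].

Definition reaches_consensus (R : realType) (n : nat) (A : 'M[R]_n) : Prop :=
  forall x0 : 'cV[R]_n,
    exists2 xs, @consensus R n xs & trajectory A x0 @ \oo --> xs.

Definition limit_state (R : realType) (n : nat) (A : 'M[R]_n) (x0 : 'cV[R]_n) :
    'cV[R]_n :=
  limn (trajectory A x0).

(* The norm [`|x|] that the library puts on matrices is the maximum of the
   absolute values of the entries, i.e. the infinity norm on column vectors. *)
Definition norm2 (R : realType) (n : nat) (x : 'cV[R]_n) : R :=
  Num.sqrt (\sum_(i < n) x i 0 ^+ 2).

Definition root_ratio (R : realType) (n : nat) (A : 'M[R]_n) (x0 : 'cV[R]_n)
    (t : nat) : R :=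
  (norm2 (trajectory A x0 t - limit_state A x0) /
   norm2 (x0 - limit_state A x0)) `^ t%:R^-1.

Definition asymptotic_rates (R : realType) (n : nat) (A : 'M[R]_n) : set R :=
  [set limn (root_ratio A x0) | x0 in ~` @consensus R n].

(* [limn] and [sup] are total, with an arbitrary value where the limit or the
   supremum does not exist; the first three components say that all of them
   exist. *)
Definition is_convergence_rate (R : realType) (n : nat) (A : 'M[R]_n) (rho : R) :
    Prop :=
  [/\ reaches_consensus A,
      (forall x0, ~ consensus x0 -> cvgn (root_ratio A x0)),
      has_sup (asymptotic_rates A) &
      rho = sup (asymptotic_rates A)].

Definition settled_from (R : realType) (n : nat) (A : 'M[R]_n) (eps : R)
    (tau : nat) : Prop :=
  forall (t : nat) (x0 : 'cV[R]_n), (tau <= t)%N -> ~ consensus x0 ->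
    `|trajectory A x0 t - limit_state A x0| / `|x0 - limit_state A x0| <= eps.

Definition is_convergence_time (R : realType) (n : nat) (A : 'M[R]_n) (eps : R)
    (T : nat) : Prop :=
  [/\ reaches_consensus A,
      settled_from A eps T &
      forall tau, settled_from A eps tau -> (T <= tau)%N].

Definition log2 (R : realType) (x : R) : R := ln x / ln 2.

(* Main.v *)
Require Import Defs.
From mathcomp Require Import all_boot all_order all_algebra.
From mathcomp Require Import all_classical all_reals all_analysis.
From mathcomp Require Import ring lra.

(** Let [w i] be the degree of node [i], self-arc included. The matrix [A] is
    self-adjoint for the inner product <x, y> = \sum_i w i * x i * y i, and it
    fixes the constant vectors; so [x(t)] minus the [w]-weighted mean of [x(0)]
    is the iteration restarted inside the orthogonal complement of the
    constants. Everything follows from the operator norm of [A] there, which is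
    at most [q = 1 - 1 / (3 n^2)].

    For a self-adjoint operator the operator norm is bounded by the quadratic
    form ([self_adjoint_contraction]), so both ends of the spectrum are to be
    kept away from 1 and -1.
    - Upper end. <x, x> - <x, A x> is the sum of [(x_i - x_j)^2] over the edges.
      If [x] has weighted mean 0 and [|x_k|] is maximal, some [x_j] satisfies
      [x_k x_j <= 0], so [x_k^2 <= (x_k - x_j)^2], which Cauchy-Schwarz along a
      simple path bounds by [n] times the edge sum ([path_energy]).
      Since <x, x> is at most [x_k^2] times the total degree, this is a
      Poincare inequality ([poincare]) whose constant involves the total degree
      of the graph. That is where being a tree matters: an acyclic graph loses
      at most one edge with each leaf removed, so the total degree is at most
      [3 n] ([tree_sum_degrees]).
    - Lower end. <x, x> + <x, A x> is a sum of [(x_i + x_j)^2] in which the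
      self-arcs alone contribute [2 \sum_i x_i^2 >= (2 / n) <x, x>].

    The two bounds together are [equal_neighbor_numerical_radius].

    The limit defining the rate exists without diagonalizing [A]: by
    self-adjointness and Cauchy-Schwarz, [u t = |A^t y| / |y|] is log-convex
    with [u 0 = 1], so [u t ^ (1 / t)] is nondecreasing; it is bounded by [q],
    hence converges ([log_convex_cvg_roots]). Passing to the Euclidean norm costs
    constant factors, whose [t]-th roots tend to 1 ([cvg_roots_equivalent]).

    For the convergence time, the weighted norm exceeds the maximum norm by a
    factor at most [sqrt (3 n) <= n^2], and [q^t <= exp (- t / (3 n^2))], so
    [t >= 6 n^2 ln (n / eps)] is enough ([mixing_time_bound]). *)

Set Implicit Arguments.
Unset Strict Implicit.
Unset Printing Implicit Defensive.

Import Order.TTheory GRing.Theory Num.Theory.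
Import numFieldNormedType.Exports.

Local Open Scope classical_set_scope.
Local Open Scope ring_scope.

(** * Acyclic graphs have few edges *)

(** An end [x] of a longest simple path inside [S] is a leaf: maximality puts
    all neighbors of [x] on the path, and a neighbor beyond the first would
    close a cycle of length at least three. *)
Lemma acyclic_leaf (T : finType) (adj : rel T) (S : {set T}) :
  symmetric adj -> irreflexive adj ->
  (forall s : seq T, ucycle adj s -> (size s < 3)%N) ->
  S != finset.set0 -> exists2 x, x \in S & (\sum_(j in S) adj x j <= 1)%N.
Proof.
move=> sym_adj irr_adj acyc /set0Pn[x0 Sx0].
(* [P m]: some simple path with [m] edges stays inside [S]. *)
pose P m := [exists x in S, exists p : m.-tuple T,
  [&& path adj x p, uniq (x :: p) & all [in S] p]].
have exP : exists m, P m.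
  exists 0%N; apply/existsP; exists x0; rewrite Sx0 /=.
  by apply/existsP; exists [tuple].
have ubP m : P m -> (m <= #|T|)%N.
  case/existsP=> x /andP[_ /existsP[p /and3P[_ Up _]]].
  have := card_size (x :: p); rewrite (card_uniqP Up) /= size_tuple => H.
  by rewrite ltnW // (leq_trans _ (max_card (mem (x :: p)))) // (card_uniqP Up) /= size_tuple.
case: (ex_maxnP exP ubP) => m /existsP[x /andP[Sx /existsP[p /and3P[xp Up Sp]]]] maxm.
exists x => //.
(* Otherwise [y :: x :: p] would be a longer path. *)
have inp y : y \in S -> adj x y -> y \in tval p.
  move=> Sy xy; apply: contraT => pNy.
  have : P m.+1.
    apply/existsP; exists y; rewrite Sy; apply/existsP; exists [tuple of x :: p].
    have yx : y != x by apply/eqP => yx; rewrite yx irr_adj in xy.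
    by move: Up; rewrite /= sym_adj xy xp Sx Sp inE negb_or yx pNy => ->.
  by move/maxm; rewrite ltnn.
(* Otherwise the segment of the path from [x] to [y] is a cycle. *)
have hd y : y \in S -> adj x y -> y = head x p.
  move=> Sy xy; have := inp y Sy xy => py.
  move: xp Up; case/splitPr: py => [[|z s1] s2] //= => /andP[xz].
  rewrite cat_path /= => /and3P[zs1 lasty _] Up.
  suff /acyc : ucycle adj [:: x, z & rcons s1 y] by rewrite /= size_rcons.
  rewrite /ucycle /= xz rcons_path last_rcons sym_adj xy andbT.
  rewrite rcons_path zs1 lasty /=.
  move: Up; rewrite -cat_rcons cat_uniq !inE !mem_cat !negb_or.
  by case/and3P=> [/and3P[-> -> _] /andP[-> _] /andP[-> _]].
rewrite (bigID [pred j | j == head x p]) /=.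
rewrite [X in (_ + X)%N]big1 ?addn0; last first.
  move=> j /andP[Sj jh]; case E: (adj x j) => //.
  by rewrite (hd _ Sj E) eqxx in jh.
rewrite -big_filter.
apply: (@leq_trans (\sum_(j | j == head x p) 1)%N); last by rewrite big_pred1_eq.
rewrite big_filter big_mkcondl /=; apply: leq_sum => j _.
by case: ifP => // _; case: (adj _ _).
Qed.

(** Every undirected edge is counted twice here. Removing a leaf removes at
    most one edge, hence induction on the number of vertices. *)
Lemma acyclic_edges (T : finType) (adj : rel T) (S : {set T}) :
  symmetric adj -> irreflexive adj ->
  (forall s : seq T, ucycle adj s -> (size s < 3)%N) ->
  (\sum_(i in S) \sum_(j in S) adj i j <= 2 * #|S|)%N.
Proof.
move=> sym_adj irr_adj acyc; move: {2}#|S| (erefl #|S|) => m.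
elim: m S => [|m IH] S cS.
  by move/eqP: cS; rewrite cards_eq0 => /eqP->; rewrite big_set0.
have [|x Sx lex] := @acyclic_leaf T adj S sym_adj irr_adj acyc.
  by rewrite -card_gt0 cS.
have cS' : #|S :\ x|%SET = m.
  by have := cardsD1 x S; rewrite Sx cS add1n => -[].
have := IH _ cS'; rewrite cS' cS => IHm.
rewrite (big_setD1 x Sx) /=.
under [X in (_ + X)%N]eq_bigr do rewrite (big_setD1 x Sx) /=.
rewrite big_split /= addnA mulnS leq_add //.
apply: (@leq_add _ _ 1 1) => //; apply: leq_trans lex.
rewrite [leqRHS](big_setD1 x Sx) /= irr_adj add0n.
by apply: leq_sum => i _; rewrite sym_adj.
Qed.

(** * Dirichlet energy and the Poincare inequality *)

(** The induction step of Cauchy-Schwarz along a path, in the form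
    [(a + b)^2 <= (m + 1) (a^2 + b^2 / m)]; the factors 2 match the energy
    below, where each edge occurs in both directions. *)
Lemma sqr_telescope_step (R : realFieldType) (m : nat) (a b S W : R) :
  2 * b ^+ 2 <= m%:R * S -> S + 2 * a ^+ 2 <= W -> 0 <= S ->
  2 * (a + b) ^+ 2 <= m.+1%:R * W.
Proof.
move=> hb hW S0.
apply: (@le_trans _ _ (m.+1%:R * (S + 2 * a ^+ 2))); last first.
  by apply: ler_wpM2l => //; rewrite ler0n.
rewrite -natr1; case: m hb => [|m] hb.
  rewrite mul0r in hb.
  have b0 : b = 0.
    by apply/eqP; rewrite -sqrf_eq0; apply/eqP; have := sqr_ge0 b; lra.
  rewrite b0; lra.
set k : R := m.+1%:R in hb *.
have k0 : 0 < k by rewrite /k ltr0n.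
have key : 2 * (2 * a * b) <= 2 * k * a ^+ 2 + S.
  rewrite -(ler_pM2l k0).
  have := sqr_ge0 (k * a - b); rewrite !expr2; rewrite !expr2 in hb; nra.
rewrite !expr2 in hb key *; lra.
Qed.

(** On a symmetric relation each undirected edge is counted in both
    directions, so this is twice the usual Dirichlet form. *)
Definition energy (R : realFieldType) (T : finType) (e : rel T) (f : T -> R) : R :=
  \sum_i \sum_j (e i j)%:R * (f i - f j) ^+ 2.

Lemma energy_term_ge0 (R : realFieldType) (T : finType) (e : rel T) (f : T -> R) i j :
  0 <= (e i j)%:R * (f i - f j) ^+ 2.
Proof. by rewrite mulr_ge0 ?sqr_ge0 ?ler0n. Qed.

(** Cauchy-Schwarz on the telescoping sum along the path; since the path is
    simple, its edges are distinct and their squared increments are bounded by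
    the energy. *)
Lemma path_energy (R : realFieldType) (T : finType) (e : rel T) (f : T -> R) x p :
  symmetric e -> path e x p -> uniq (x :: p) ->
  2 * (f x - f (last x p)) ^+ 2 <= (size p)%:R * energy e f.
Proof.
move=> sym_e xp Up; pose g i j := (e i j)%:R * (f i - f j) ^+ 2.
have g0 i j : 0 <= g i j := energy_term_ge0 e f i j.
(* The energy is first restricted to the vertices of the path, for which
   the induction on the path goes through. *)
apply: (@le_trans _ _ ((size p)%:R *
   \sum_(i <- x :: p) \sum_(j <- x :: p) g i j)); last first.
  apply: ler_wpM2l; first exact: ler0n.
  rewrite /energy (big_uniq _ Up) [leRHS](bigID (mem (x :: p))) /=.
  apply: ler_wpDr; first by do 2![apply: sumr_ge0 => ? _]; exact: g0.
  apply: ler_sum => i _.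
  rewrite (big_uniq _ Up) [leRHS](bigID (mem (x :: p))) /=.
  by apply: ler_wpDr => //; apply: sumr_ge0 => ? _; exact: g0.
elim: p x xp {Up} => [|y p IH] x /=; first by rewrite subrr expr0n mulr0 mul0r.
case/andP=> xy /IH hb.
rewrite -(subrKA (f y)); apply: sqr_telescope_step hb _ _; last first.
  by apply: sumr_ge0 => i _; apply: sumr_ge0.
rewrite [leRHS]big_cons (eq_bigr _ (fun i _ => big_cons _ _ _ _ _ _)).
rewrite big_split /= [\sum_(i <- y :: p) g i x]big_cons.
rewrite [\sum_(j <- [:: x, y & p]) _]big_cons [\sum_(j <- y :: p) g x j]big_cons.
set S := \sum_(i <- y :: p) \sum_(j <- y :: p) g i j.
have -> : 2 * (f x - f y) ^+ 2 = g x y + g y x.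
  by rewrite /g [e y x]sym_e xy !mul1r; ring.
have := g0 x x.
have : 0 <= \sum_(j <- p) g x j by apply: sumr_ge0.
have : 0 <= \sum_(j <- p) g j x by apply: sumr_ge0.
lra.
Qed.

(** A function of weighted mean zero cannot have everywhere the strict sign of
    its extreme value [f k]; the energy of a path from [k] to a node where
    that sign fails controls the extreme value, hence the whole weighted square sum. *)
Lemma poincare (R : realFieldType) (n : nat) (e : rel 'I_n) (w f : 'I_n -> R) :
  symmetric e -> (forall i j, connect e i j) -> (forall i, 0 < w i) ->
  \sum_i w i * f i = 0 ->
  2 * \sum_i w i * f i ^+ 2 <= (\sum_i w i) * n%:R * energy e f.
Proof.
case: n e w f => [|n] e w f sym_e conn_e w0 mean0.
  by rewrite !big_ord0 mulr0 !mul0r.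
have [k _ kmax] := @arg_maxP _ _ _ (@ord0 n) xpredT (fun i => `|f i|) isT.
have [j fj] : exists j, f k * f j <= 0.
  apply/existsP; apply: contraT => /existsPn H.
  suff : 0 < \sum_i w i * (f k * f i).
    under eq_bigr do rewrite mulrCA.
    by rewrite -mulr_sumr mean0 mulr0 ltxx.
  rewrite (bigD1 ord0) //= ltr_wpDr //.
    by apply: sumr_ge0 => i _; rewrite mulr_ge0 ?(ltW (w0 i)) // ltW // ltNge H.
  by rewrite mulr_gt0 // ltNge H.
have E0 : 0 <= energy e f.
  by do 2![apply: sumr_ge0 => ? _]; exact: energy_term_ge0.
have fk : 2 * f k ^+ 2 <= n.+1%:R * energy e f.
  have [p kp jE] := connectP (conn_e k j).
  move: fj; rewrite jE; case/shortenP: kp => s ks Us _ fj.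
  have size_s : (size s <= n.+1)%N.
    by have := max_card (mem (k :: s)); rewrite (card_uniqP Us) card_ord => /ltnW.
  apply: (@le_trans _ _ (2 * (f k - f (last k s)) ^+ 2)).
    by have := sqr_ge0 (f (last k s)); rewrite !expr2; lra.
  apply: le_trans (path_energy f sym_e ks Us) _.
  by rewrite ler_wpM2r // ler_nat.
rewrite mulr_sumr -mulrA mulr_suml; apply: ler_sum => i _.
rewrite mulrCA; apply: ler_wpM2l; first exact: ltW.
apply: le_trans fk; rewrite ler_pM2l //.
rewrite -[leLHS]real_normK ?num_real // -[leRHS]real_normK ?num_real //.
by rewrite lerXn2r ?nnegrE //; exact: kmax.
Qed.

(** * Self-adjoint iterations *)

Definition wdot (R : realType) (n : nat) (w : 'I_n -> R) (x y : 'cV[R]_n) : R :=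
  \sum_i w i * (x i 0 * y i 0).

Definition wnorm (R : realType) (n : nat) (w : 'I_n -> R) (x : 'cV[R]_n) : R :=
  Num.sqrt (wdot w x x).

Lemma wdotC (R : realType) (n : nat) (w : 'I_n -> R) x y :
  wdot w x y = wdot w y x.
Proof. by apply: eq_bigr => i _; rewrite [x i 0 * _]mulrC. Qed.

Lemma wdotDl (R : realType) (n : nat) (w : 'I_n -> R) x y z :
  wdot w (x + y) z = wdot w x z + wdot w y z.
Proof. by rewrite -big_split; apply: eq_bigr => i _; rewrite mxE mulrDl mulrDr. Qed.

Lemma wdotZl (R : realType) (n : nat) (w : 'I_n -> R) k x y :
  wdot w (k *: x) y = k * wdot w x y.
Proof. by rewrite mulr_sumr; apply: eq_bigr => i _; rewrite mxE; ring. Qed.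

Lemma wdotDr (R : realType) (n : nat) (w : 'I_n -> R) x y z :
  wdot w x (y + z) = wdot w x y + wdot w x z.
Proof. by rewrite wdotC wdotDl !(wdotC w x). Qed.

Lemma wdotZr (R : realType) (n : nat) (w : 'I_n -> R) k x y :
  wdot w x (k *: y) = k * wdot w x y.
Proof. by rewrite wdotC wdotZl wdotC. Qed.

Lemma wdot_ge0 (R : realType) (n : nat) (w : 'I_n -> R) x :
  (forall i, 0 < w i) -> 0 <= wdot w x x.
Proof.
move=> w0; apply: sumr_ge0 => i _.
by rewrite (mulr_ge0 (ltW (w0 i))) // -expr2 sqr_ge0.
Qed.

Lemma wdot_gt0 (R : realType) (n : nat) (w : 'I_n -> R) x :
  (forall i, 0 < w i) -> x != 0 -> 0 < wdot w x x.
Proof.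
move=> w0 xN0; rewrite lt_neqAle wdot_ge0 // andbT eq_sym.
apply: contra_neq xN0 => /psumr_eq0P h; apply/colP => i; rewrite mxE.
have := h (fun i _ => mulr_ge0 (ltW (w0 i)) (sqr_ge0 (x i 0))) i isT.
by move/eqP; rewrite mulf_eq0 gt_eqF //= -expr2 sqrf_eq0 => /eqP.
Qed.

(** Expand the square norm of <y, y> x - <x, y> y. *)
Lemma wdot_CauchySchwarz (R : realType) (n : nat) (w : 'I_n -> R) x y :
  (forall i, 0 < w i) -> wdot w x y ^+ 2 <= wdot w x x * wdot w y y.
Proof.
move=> w0; have [->|yN0] := eqVneq y 0.
  rewrite -[0](scale0r 0) !wdotZr; lra.
have y0 := wdot_gt0 w0 yN0.
have := wdot_ge0 (wdot w y y *: x + (- wdot w x y) *: y) w0.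
rewrite !(wdotDl, wdotDr, wdotZl, wdotZr) (wdotC w y x) => h.
rewrite -subr_ge0 -(pmulr_rge0 _ y0); apply: le_trans h _.
by rewrite le_eqVlt; apply/orP; left; apply/eqP; ring.
Qed.

Definition self_adjoint (R : realType) (n : nat) (w : 'I_n -> R) (A : 'M[R]_n) :=
  forall x y, wdot w (A *m x) y = wdot w x (A *m y).

(** The numerical radius of a self-adjoint operator bounds its norm: apply
    the hypothesis to [x + y] and [x - y] with [y = q^-1 A x] and subtract.
    Only the complement of the fixed vector [v] matters, and
    self-adjointness makes it invariant. *)
Lemma self_adjoint_contraction (R : realType) (n : nat) (w : 'I_n -> R)
    (A : 'M[R]_n) (v : 'cV[R]_n) (q : R) :
  (forall i, 0 < w i) -> self_adjoint w A -> A *m v = v -> 0 < q ->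
  (forall x, wdot w v x = 0 -> `|wdot w x (A *m x)| <= q * wdot w x x) ->
  forall x, wdot w v x = 0 ->
    wdot w (A *m x) (A *m x) <= q ^+ 2 * wdot w x x.
Proof.
move=> w0 sA Av q0 hq x vx.
have vAx : wdot w v (A *m x) = 0 by rewrite -sA Av.
pose y := q^-1 *: (A *m x).
have hp : wdot w v (x + y) = 0 by rewrite wdotDr wdotZr vx vAx; ring.
have hm : wdot w v (x + (-1) *: y) = 0.
  by rewrite wdotDr !wdotZr vx vAx; ring.
have := ler_normlP _ _ (hq _ hp) => -[_ {}hp].
have := ler_normlP _ _ (hq _ hm) => -[{}hm _].
have qV : q * q^-1 = 1 by rewrite mulfV // gt_eqF.
move: hp hm; rewrite !(mulmxDr, wdotDl, wdotDr) -!scalemxAr !(wdotZl, wdotZr).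
rewrite (wdotC w (A *m x) x) -!(sA x (A *m x)).
set X := wdot w x x; set Z := wdot w (A *m x) (A *m x).
set B := wdot w x (A *m x).
move: (q^-1) qV => r qr hp hm.
have {hp hm} : 4 * r * Z <= q * (2 * X + 2 * r ^+ 2 * Z) by rewrite !expr2; lra.
move/(ler_wpM2l (ltW q0)).
have -> : q * (4 * r * Z) = 4 * (q * r) * Z by ring.
have -> : q * (q * (2 * X + 2 * r ^+ 2 * Z)) =
  2 * q ^+ 2 * X + 2 * (q * r) ^+ 2 * Z by ring.
rewrite qr; lra.
Qed.

Lemma trajectoryS (R : realType) (n : nat) (A : 'M[R]_n) x t :
  trajectory A x t.+1 = A *m trajectory A x t.
Proof. by []. Qed.

Lemma trajectory_orthogonal (R : realType) (n : nat) (w : 'I_n -> R)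
    (A : 'M[R]_n) (v x : 'cV[R]_n) t :
  self_adjoint w A -> A *m v = v -> wdot w v x = 0 ->
  wdot w v (trajectory A x t) = 0.
Proof. by move=> sA Av vx; elim: t => // t IH; rewrite trajectoryS -sA Av. Qed.

Lemma trajectory_contraction (R : realType) (n : nat) (w : 'I_n -> R)
    (A : 'M[R]_n) (v : 'cV[R]_n) (q : R) :
  (forall i, 0 < w i) -> self_adjoint w A -> A *m v = v -> 0 < q ->
  (forall x, wdot w v x = 0 -> `|wdot w x (A *m x)| <= q * wdot w x x) ->
  forall x t, wdot w v x = 0 ->
    wnorm w (trajectory A x t) <= q ^+ t * wnorm w x.
Proof.
move=> w0 sA Av q0 hq x t vx; elim: t => [|t IH]; first by rewrite mul1r.
have := self_adjoint_contraction w0 sA Av q0 hq (trajectory_orthogonal t sA Av vx).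
rewrite -trajectoryS => /ler_wsqrtr.
rewrite sqrtrM ?sqr_ge0 // sqrtr_sqr gtr0_norm // => /le_trans; apply.
by rewrite exprS -mulrA ler_pM2l.
Qed.

(** Move one factor [A] across <A^(t+1) x, A^(t+1) x> and apply
    Cauchy-Schwarz. *)
Lemma trajectory_log_convex (R : realType) (n : nat) (w : 'I_n -> R)
    (A : 'M[R]_n) (x : 'cV[R]_n) t :
  (forall i, 0 < w i) -> self_adjoint w A ->
  wnorm w (trajectory A x t.+1) ^+ 2 <=
    wnorm w (trajectory A x t) * wnorm w (trajectory A x t.+2).
Proof.
move=> w0 sA; rewrite sqr_sqrtr ?wdot_ge0 //.
rewrite -sqrtrM ?wdot_ge0 //.
rewrite -[leLHS]ger0_norm ?wdot_ge0 // -sqrtr_sqr ler_wsqrtr //.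
by rewrite {1}trajectoryS sA -trajectoryS wdot_CauchySchwarz.
Qed.

(** * Roots of log-convex sequences *)

Lemma cvg_powR_inv (R : realType) (K : R) : 0 < K ->
  (fun t : nat => K `^ t%:R^-1) @ \oo --> (1 : R).
Proof.
move=> K0.
have -> : (fun t : nat => K `^ t%:R^-1) = (fun t : nat => expR (t%:R^-1 * ln K)).
  by apply/funext => t; rewrite /powR gt_eqF.
rewrite -[X in _ --> X]expR0; apply: continuous_cvg; first exact: continuous_expR.
rewrite -[X in _ --> X](mul0r (ln K)); apply: cvgMl.
by rewrite -cvg_shiftS; exact: cvg_harmonic.
Qed.

(** This makes [u t ^ (1 / t)] nondecreasing; clearing the roots allows an
    induction on [t]. *)
Lemma log_convex_roots (R : realType) (u : nat -> R) :
  (forall t, 0 <= u t) -> u 0 = 1 -> (forall t, u t.+1 ^+ 2 <= u t * u t.+2) ->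
  forall t, u t ^+ t.+1 <= u t.+1 ^+ t.
Proof.
move=> u0 u1 lc; elim=> [|t IH]; first by rewrite u1 expr0 expr1n.
(* Multiply the goal by [u t.+1 ^+ t], then use log-convexity and [IH]. *)
have [->|ut] := eqVneq (u t.+1) 0; first by rewrite expr0n exprn_ge0.
have ut0 : 0 < u t.+1 by rewrite lt_neqAle eq_sym ut u0.
rewrite -(ler_pM2l (exprn_gt0 t ut0)) -exprD.
have -> : (t + t.+2 = 2 * t.+1)%N by rewrite mulSn mul1n addSnnS.
rewrite exprM; apply: (@le_trans _ _ ((u t * u t.+2) ^+ t.+1)).
  by rewrite lerXn2r ?nnegrE ?sqr_ge0 ?mulr_ge0.
by rewrite exprMn ler_wpM2r ?exprn_ge0.
Qed.

Lemma log_convex_cvg_roots (R : realType) (u : nat -> R) (q : R) :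
  (forall t, 0 <= u t) -> u 0 = 1 -> (forall t, u t.+1 ^+ 2 <= u t * u t.+2) ->
  0 <= q -> (forall t, u t <= q ^+ t) ->
  exists2 l, (fun t : nat => u t `^ t%:R^-1) @ \oo --> l & l <= q.
Proof.
move=> u0 u1 lc q0 uq.
(* The exponent at [t = 0] is the junk value [0^-1], so the roots are
   monotone only from index 1 on. *)
pose v (t : nat) := u t.+1 `^ t.+1%:R^-1.
have vq t : v t <= q.
  have -> : q = (q ^+ t.+1) `^ t.+1%:R^-1.
    by rewrite -powR_mulrn // -powRrM mulfV ?pnatr_eq0 // powRr1.
  by apply: ge0_ler_powR; rewrite ?nnegrE ?invr_ge0 ?exprn_ge0.
have v_nd : nondecreasing_seq v.
  apply/nondecreasing_seqP => t.
  rewrite /v; have := log_convex_roots u0 u1 lc t.+1.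
  set a := u t.+1; set b := u t.+2 => ab.
  (* Both roots are [k]-th powers of the two sides of [ab]. *)
  pose k : R := (t.+1%:R * t.+2%:R)^-1.
  have -> : a `^ t.+1%:R^-1 = (a ^+ t.+2) `^ k.
    rewrite -powR_mulrn ?u0 // -powRrM; congr (_ `^ _).
    by rewrite /k invfM mulrCA mulfV ?mulr1 ?pnatr_eq0.
  have -> : b `^ t.+2%:R^-1 = (b ^+ t.+1) `^ k.
    rewrite -powR_mulrn ?u0 // -powRrM; congr (_ `^ _).
    by rewrite /k invfM mulVKf ?pnatr_eq0.
  by apply: ge0_ler_powR; rewrite ?nnegrE ?invr_ge0 ?exprn_ge0 ?u0 // mulr_ge0.
have cv : cvgn v.
  by apply: nondecreasing_is_cvgn => //; exists q => _ [t _ <-].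
exists (limn v); last by apply: limr_le => //; near=> t; exact: vq.
by rewrite -(cvg_shiftS (fun t : nat => u t `^ t%:R^-1)).
Unshelve. all: by end_near.
Qed.

Lemma cvg_roots_equivalent (R : realType) (u v : nat -> R) (c l : R) :
  0 < c -> (forall t, 0 <= u t) -> (forall t, 0 <= v t) ->
  (forall t, v t <= c * u t) -> (forall t, u t <= c * v t) ->
  (fun t : nat => u t `^ t%:R^-1) @ \oo --> l ->
  (fun t : nat => v t `^ t%:R^-1) @ \oo --> l.
Proof.
move=> c0 u0 v0 vu uv ul.
apply: (@squeeze_cvgr _ _ _ _
  (fun t : nat => c^-1 `^ t%:R^-1 * u t `^ t%:R^-1)
  (fun t : nat => c `^ t%:R^-1 * u t `^ t%:R^-1)).
- near=> t; rewrite -!powRM ?invr_ge0 ?(ltW c0) //; apply/andP; split.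
    apply: ge0_ler_powR; rewrite ?nnegrE ?invr_ge0 ?mulr_ge0 ?invr_ge0 ?(ltW c0) //.
    by rewrite mulrC ler_pdivrMr // mulrC.
  by apply: ge0_ler_powR; rewrite ?nnegrE ?invr_ge0 ?mulr_ge0 ?(ltW c0).
- rewrite -[X in _ --> X]mul1r; apply: cvgM ul.
  by apply: cvg_powR_inv; rewrite invr_gt0.
- by rewrite -[X in _ --> X]mul1r; apply: cvgM ul; exact: cvg_powR_inv.
Unshelve. all: by end_near.
Qed.

(** * The equal-neighbor matrix of a tree *)

Lemma card_neighbors (n : nat) (e : rel 'I_n) i :
  (#|neighbors e i| = \sum_j e j i)%N.
Proof.
rewrite -sum1_card big_mkcond /=; apply: eq_bigr => j _.
by rewrite inE; case: (e j i).
Qed.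

Lemma tree_sum_degrees (n : nat) (e : rel 'I_n) :
  bidirectional_spanning_tree e -> (\sum_i #|neighbors e i| <= 3 * n)%N.
Proof.
case=> sym_e refl_e [_ acyc].
have sym_d : symmetric (del_self_arcs e).
  by move=> i j; rewrite /del_self_arcs /= eq_sym sym_e.
have irr_d : irreflexive (del_self_arcs e) by move=> i; rewrite /del_self_arcs /= eqxx.
have := acyclic_edges [set: 'I_n]%SET sym_d irr_d acyc.
rewrite cardsT card_ord => H.
have -> : (\sum_i #|neighbors e i| =
  n + \sum_(i in [set: 'I_n]%SET) \sum_(j in [set: 'I_n]%SET) del_self_arcs e i j)%N.
  rewrite -[X in (X + _)%N](card_ord n) -[X in (X + _)%N]sum1_card.
  rewrite [X in (_ + X)%N](eq_bigl xpredT); last by move=> i; rewrite inE.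
  rewrite -big_split /=; apply: eq_bigr => i _.
  rewrite card_neighbors (bigD1 i) //= refl_e; congr (_ + _)%N.
  rewrite [RHS](bigD1 i) ?inE //= {1}/del_self_arcs /= eqxx add0n.
  apply: eq_big => [j|j ji]; first by rewrite inE.
  by rewrite /del_self_arcs /= eq_sym ji sym_e.
by rewrite (mulnDl 1 2) mul1n leq_add2l.
Qed.

Definition degree (R : realType) (n : nat) (e : rel 'I_n) (i : 'I_n) : R :=
  #|neighbors e i|%:R.

Lemma degreeE (R : realType) (n : nat) (e : rel 'I_n) i :
  symmetric e -> degree R e i = \sum_j (e i j)%:R.
Proof.
move=> sym_e; rewrite /degree card_neighbors natr_sum.
by apply: eq_bigr => j _; rewrite sym_e.
Qed.

Lemma degree_ge1 (R : realType) (n : nat) (e : rel 'I_n) i :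
  reflexive e -> 1 <= degree R e i.
Proof.
move=> refl_e; rewrite ler1n card_gt0; apply/set0Pn; exists i.
by rewrite inE refl_e.
Qed.

Lemma degree_gt0 (R : realType) (n : nat) (e : rel 'I_n) i :
  reflexive e -> 0 < degree R e i.
Proof. by move=> refl_e; apply: lt_le_trans (degree_ge1 R i refl_e). Qed.

Lemma degree_len (R : realType) (n : nat) (e : rel 'I_n) i :
  degree R e i <= n%:R.
Proof. by rewrite ler_nat -[leqRHS]card_ord max_card. Qed.

Lemma equal_neighbor_wdot (R : realType) (n : nat) (e : rel 'I_n) (x y : 'cV[R]_n) :
  symmetric e -> reflexive e ->
  wdot (degree R e) x (equal_neighbor_mx R e *m y) =
    \sum_i \sum_j (e i j)%:R * (x i 0 * y j 0).
Proof.
move=> sym_e refl_e; apply: eq_bigr => i _; rewrite mxE.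
rewrite mulrA mulr_sumr; apply: eq_bigr => j _.
rewrite mxE inE sym_e; case: (e i j); last by rewrite mul0r mulr0 mul0r.
rewrite -/(degree R e i).
have := degree_gt0 R i refl_e; move: (degree R e i) => d d0.
by rewrite mulrACA mulfV ?gt_eqF // -!mulrA; ring.
Qed.

Lemma equal_neighbor_self_adjoint (R : realType) (n : nat) (e : rel 'I_n) :
  symmetric e -> reflexive e ->
  self_adjoint (degree R e) (equal_neighbor_mx R e).
Proof.
move=> sym_e refl_e x y; rewrite wdotC !equal_neighbor_wdot // exchange_big /=.
by do 2![apply: eq_bigr => ? _]; rewrite sym_e [y _ _ * _]mulrC.
Qed.

Lemma equal_neighbor_const (R : realType) (n : nat) (e : rel 'I_n) (c : R) :
  reflexive e -> equal_neighbor_mx R e *m const_mx c = const_mx c :> 'cV[R]_n.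
Proof.
move=> refl_e; apply/colP => i; rewrite !mxE.
under eq_bigr do rewrite !mxE.
rewrite -mulr_suml -big_mkcond /= sumr_const -[_ *+ _]mulr_natr.
by rewrite mulVf ?mul1r // gt_eqF ?(degree_gt0 R i).
Qed.

Lemma wdot_degree (R : realType) (n : nat) (e : rel 'I_n) (x : 'cV[R]_n) :
  symmetric e ->
  wdot (degree R e) x x = \sum_i \sum_j (e i j)%:R * x i 0 ^+ 2.
Proof.
move=> sym_e; apply: eq_bigr => i _.
by rewrite degreeE // mulr_suml; apply: eq_bigr => j _; rewrite expr2.
Qed.

(** For [s = -1] the right-hand side is the energy; for [s = 1] it is the
    form that measures the distance of the spectrum from -1. *)
Lemma wdot_degree_pm (R : realType) (n : nat) (e : rel 'I_n) (x : 'cV[R]_n) (s : R) :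
  symmetric e -> reflexive e -> s ^+ 2 = 1 ->
  2 * (wdot (degree R e) x x + s * wdot (degree R e) x (equal_neighbor_mx R e *m x)) =
  \sum_i \sum_j (e i j)%:R * (x i 0 + s * x j 0) ^+ 2.
Proof.
move=> sym_e refl_e s2; rewrite equal_neighbor_wdot // wdot_degree //.
set B := \sum_i \sum_j (e i j)%:R * (x i 0 * x j 0).
have -> : \sum_i \sum_j (e i j)%:R * (x i 0 + s * x j 0) ^+ 2 =
    \sum_i \sum_j (e i j)%:R * x i 0 ^+ 2 +
    \sum_i \sum_j (e i j)%:R * x j 0 ^+ 2 + 2 * s * B.
  rewrite mulr_sumr -!big_split; apply: eq_bigr => i _ /=.
  rewrite mulr_sumr -!big_split; apply: eq_bigr => j _ /=.
  by rewrite sqrrD exprMn s2; ring.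
have -> : \sum_i \sum_j (e i j)%:R * x j 0 ^+ 2 =
    \sum_i \sum_j (e i j)%:R * x i 0 ^+ 2.
  by rewrite exchange_big; do 2![apply: eq_bigr => ? _]; rewrite sym_e.
ring.
Qed.

(** The spectral gap at both ends: near 1 by the Poincare inequality, near
    -1 by the self-arcs. *)
Lemma equal_neighbor_numerical_radius (R : realType) (n : nat) (e : rel 'I_n)
    (x : 'cV[R]_n) :
  (0 < n)%N -> symmetric e -> reflexive e -> (forall i j, connect e i j) ->
  (\sum_i #|neighbors e i| <= 3 * n)%N ->
  wdot (degree R e) (const_mx 1) x = 0 ->
  `|wdot (degree R e) x (equal_neighbor_mx R e *m x)| <=
    (1 - 1 / (3 * n%:R ^+ 2)) * wdot (degree R e) x x.
Proof.
move=> n_gt0 sym_e refl_e conn_e sparse mean0.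
set Q := wdot _ x x; set B := wdot _ x _.
have n1 : 1 <= n%:R :> R by rewrite ler1n.
have n0 : 0 < n%:R :> R by rewrite ltr0n.
have hm := @wdot_degree_pm R n e x (-1) sym_e refl_e (etrans (sqrrN 1) (expr1n _ _)).
have hp := @wdot_degree_pm R n e x 1 sym_e refl_e (expr1n _ _).
rewrite -/Q -/B in hm hp.
have d0 i := degree_gt0 R i refl_e.
have Q0 : 0 <= Q := wdot_ge0 x d0.
pose d : R := (3 * n%:R ^+ 2)^-1.
have nd : 3 * n%:R ^+ 2 * d = 1 by rewrite mulfV // mulf_neq0 ?expf_neq0 // gt_eqF.
have dg0 : 0 < d by rewrite invr_gt0 mulr_gt0 // exprn_gt0.
rewrite div1r -/d.
have gap : d * Q <= Q - B.
  have mean0' : \sum_i degree R e i * x i 0 = 0.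
    by apply: etrans mean0; apply: eq_bigr => i _; rewrite mxE mul1r.
  have := poincare sym_e conn_e d0 mean0'.
  have -> : \sum_i degree R e i * x i 0 ^+ 2 = Q.
    by apply: eq_bigr => i _; rewrite expr2.
  have -> : energy e (x ^~ 0) = 2 * (Q + -1 * B).
    rewrite hm; do 2![apply: eq_bigr => ? _]; congr (_ * _ ^+ 2); ring.
  have deg3 : \sum_i degree R e i <= 3 * n%:R.
    by rewrite -natr_sum -natrM ler_nat.
  have QB0 : 0 <= Q + -1 * B.
    have : 0 <= 2 * (Q + -1 * B).
      by rewrite hm; do 2![apply: sumr_ge0 => ? _]; rewrite mulr_ge0 ?sqr_ge0.
    lra.
  move=> h; have {h} : 2 * Q <= 3 * n%:R * n%:R * (2 * (Q + -1 * B)).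
    apply: le_trans h _; rewrite ler_wpM2r ?mulr_ge0 //.
    by rewrite ler_wpM2r.
  move/(ler_wpM2l (ltW dg0)).
  have -> : d * (3 * n%:R * n%:R * (2 * (Q + -1 * B))) =
    3 * n%:R ^+ 2 * d * (2 * (Q + -1 * B)) by ring.
  rewrite nd; lra.
have lazy : d * Q <= Q + B.
  (* Keep only the self-arcs, which contribute [(2 * x i 0)^2] each, and
     bound the degrees by [n]. *)
  have self : 4 * Q <= n%:R * (2 * (Q + 1 * B)).
    rewrite hp /Q /wdot !mulr_sumr; apply: ler_sum => i _.
    rewrite mulrCA -expr2.
    apply: (@le_trans _ _ (n%:R * (4 * x i 0 ^+ 2))).
      by rewrite ler_wpM2r ?degree_len // mulr_ge0 ?sqr_ge0.
    apply: ler_wpM2l; first exact: ltW.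
    rewrite (bigD1 i) //= refl_e ler_wpDr //; last by rewrite !mul1r !expr2; lra.
    by apply: sumr_ge0 => j _; rewrite mulr_ge0 ?sqr_ge0.
  have dn : d * n%:R <= 1.
    have : n%:R <= 3 * n%:R ^+ 2 :> R by rewrite expr2; nra.
    by move/(ler_wpM2l (ltW dg0)); rewrite [d * (_ * _)]mulrC nd.
  have QB0 : 0 <= Q + B by nra.
  have := ler_wpM2r QB0 dn.
  move/(ler_wpM2l (ltW dg0)): self.
  have -> : d * (n%:R * (2 * (Q + 1 * B))) = 2 * (d * n%:R * (Q + B)) by ring.
  lra.
by rewrite ler_norml; apply/andP; split; lra.
Qed.

(** * Rate and limit of a contracting iteration *)

(** The coefficient of the orthogonal projection of [x] onto the constants;
    it is the consensus value, being conserved by the iteration. *)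
Definition wmean (R : realType) (n : nat) (w : 'I_n -> R) (x : 'cV[R]_n) : R :=
  wdot w (const_mx 1) x / wdot w (const_mx 1) (const_mx 1).

Lemma wdot_centered (R : realType) (n : nat) (w : 'I_n -> R) (x : 'cV[R]_n) :
  (0 < n)%N -> (forall i, 0 < w i) ->
  wdot w (const_mx 1) (x - const_mx (wmean w x)) = 0.
Proof.
move=> n_gt0 w0.
have one0 : (const_mx 1 : 'cV[R]_n) != 0.
  by apply/eqP => /colP/(_ (Ordinal n_gt0)); rewrite !mxE => /eqP; rewrite oner_eq0.
have := wdot_gt0 w0 one0 => W0.
have -> : x - const_mx (wmean w x) = x + (- wmean w x) *: const_mx 1.
  by congr (_ + _); apply/colP => i; rewrite !mxE mulr1.
by rewrite wdotDr wdotZr mulNr divfK ?subrr // gt_eqF.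
Qed.

Lemma trajectoryB_const (R : realType) (n : nat) (A : 'M[R]_n) (x : 'cV[R]_n) c t :
  A *m const_mx c = const_mx c :> 'cV[R]_n ->
  trajectory A x t - const_mx c = trajectory A (x - const_mx c) t.
Proof.
by move=> Ac; elim: t => // t IH; rewrite !trajectoryS -IH mulmxBr Ac.
Qed.

Lemma norm_le_wnorm (R : realType) (n : nat) (w : 'I_n -> R) (x : 'cV[R]_n) :
  (forall i, 1 <= w i) -> `|x| <= wnorm w x.
Proof.
move=> w1; rewrite [leLHS]/Num.Def.normr /= mx_normrE.
apply: bigmax_le => [|[i j] _ /=]; first exact: sqrtr_ge0.
rewrite (ord1 j) -sqrtr_sqr; apply: ler_wsqrtr.
have w0 k : 0 < w k by apply: lt_le_trans (w1 k).
rewrite /wdot (bigD1 i) //= ler_wpDr //.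
  by apply: sumr_ge0 => k _; rewrite (mulr_ge0 (ltW (w0 k))) // -expr2 sqr_ge0.
by rewrite -expr2 ler_peMl ?sqr_ge0.
Qed.

Lemma wnorm_le_norm (R : realType) (n : nat) (w : 'I_n -> R) (x : 'cV[R]_n) :
  (forall i, 0 < w i) -> wnorm w x <= Num.sqrt (\sum_i w i) * `|x|.
Proof.
move=> w0; rewrite -[`|x|]ger0_norm // -sqrtr_sqr -sqrtrM; last first.
  by apply: sumr_ge0 => i _; exact: ltW.
apply: ler_wsqrtr; rewrite mulr_suml; apply: ler_sum => i _.
rewrite ler_pM2l // -expr2 -[leLHS]real_normK ?num_real //.
rewrite lerXn2r ?nnegrE //.
by rewrite [leRHS]/Num.Def.normr /= mx_normrE (le_bigmax _ _ (i, 0)).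
Qed.

Lemma norm2_le_wnorm (R : realType) (n : nat) (w : 'I_n -> R) (x : 'cV[R]_n) :
  (forall i, 1 <= w i) -> norm2 x <= wnorm w x.
Proof.
move=> w1; apply: ler_wsqrtr; apply: ler_sum => i _.
by rewrite -expr2 ler_peMl ?sqr_ge0.
Qed.

Lemma wnorm_le_norm2 (R : realType) (n : nat) (w : 'I_n -> R) (x : 'cV[R]_n) K :
  0 <= K -> (forall i, w i <= K) -> wnorm w x <= Num.sqrt K * norm2 x.
Proof.
move=> K0 wK; rewrite -sqrtrM //; apply: ler_wsqrtr.
rewrite mulr_sumr; apply: ler_sum => i _.
by rewrite -expr2 ler_wpM2r ?sqr_ge0.
Qed.

Definition contracts (R : realType) (n : nat) (w : 'I_n -> R) (A : 'M[R]_n) (q : R) :=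
  forall y t, wdot w (const_mx 1) y = 0 ->
    wnorm w (trajectory A y t) <= q ^+ t * wnorm w y.

Section Contracting.
Variables (R : realType) (n : nat) (w : 'I_n -> R) (A : 'M[R]_n) (q : R).
Hypotheses (n_gt0 : (0 < n)%N) (w1 : forall i, 1 <= w i).
Hypothesis A_const : forall c, A *m const_mx c = const_mx c :> 'cV[R]_n.
Hypotheses (q0 : 0 <= q) (q1 : q < 1) (contrA : contracts w A q).

Let w0 i : 0 < w i. Proof. exact: lt_le_trans (w1 i). Qed.

Lemma contracting_cvg x0 : trajectory A x0 @ \oo --> const_mx (wmean w x0).
Proof.
apply/subr_cvg0/norm_cvg0P.
pose y := x0 - const_mx (wmean w x0).
apply: (@squeeze_cvgr _ _ _ _ (fun=> 0) (fun t => wnorm w y * q ^+ t)).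
- near=> t; rewrite normr_ge0 /= trajectoryB_const //.
  apply: le_trans (norm_le_wnorm _ w1) _.
  by rewrite mulrC; apply: contrA; exact: wdot_centered.
- exact: cvg_cst.
- by apply: cvg_geometric; rewrite ger0_norm.
Unshelve. all: by end_near.
Qed.

Lemma contracting_limit x0 : limit_state A x0 = const_mx (wmean w x0).
Proof. by apply: cvg_lim; [exact: norm_hausdorff|exact: contracting_cvg]. Qed.

Lemma contracting_consensus : reaches_consensus A.
Proof.
move=> x0; exists (const_mx (wmean w x0)); last exact: contracting_cvg.
by exists (wmean w x0).
Qed.

Lemma deviation_neq0 x0 : ~ consensus x0 -> x0 - const_mx (wmean w x0) != 0.
Proof. by move=> nc; apply/eqP => /subr0_eq h; apply: nc; exists (wmean w x0). Qed.

(** The [w]-norm ratios are log-convex and their roots converge; the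
    Euclidean ratios differ from them by a factor bounded above and below. *)
Lemma contracting_root_ratio x0 : self_adjoint w A -> ~ consensus x0 ->
  exists2 l, root_ratio A x0 @ \oo --> l & l <= q.
Proof.
move=> sA nc; have yN0 := deviation_neq0 nc.
have -> : root_ratio A x0 = fun t =>
    (norm2 (trajectory A (x0 - const_mx (wmean w x0)) t) /
     norm2 (x0 - const_mx (wmean w x0))) `^ t%:R^-1.
  by apply/funext => t; rewrite /root_ratio contracting_limit trajectoryB_const.
have ymean := wdot_centered x0 n_gt0 w0.
move: (x0 - _) yN0 ymean => y yN0 ymean.
have wy0 : 0 < wnorm w y by rewrite sqrtr_gt0 wdot_gt0.
pose K : R := \sum_i w i.
have wK i : w i <= K.
  by rewrite /K (bigD1 i) //= ler_wpDr // sumr_ge0 // => j _; exact: ltW.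
have K0 : 0 < K by apply: lt_le_trans (wK (Ordinal n_gt0)).
have sK0 : 0 < Num.sqrt K by rewrite sqrtr_gt0.
have wn z := wnorm_le_norm2 z (ltW K0) wK.
have ny0 : 0 < norm2 y.
  by have := lt_le_trans wy0 (wn y); rewrite pmulr_rgt0.
pose u t := wnorm w (trajectory A y t) / wnorm w y.
have u_ge0 t : 0 <= u t by rewrite divr_ge0 ?sqrtr_ge0.
have [|||t|l ul lq] := @log_convex_cvg_roots R u q u_ge0.
- by rewrite /u divff // gt_eqF.
- move=> t; rewrite /u expr_div_n mulrACA -invfM -expr2.
  by rewrite ler_pM2r ?invr_gt0 ?exprn_gt0 // trajectory_log_convex.
- exact: q0.
- by rewrite ler_pdivrMr //; exact: contrA.
exists l => //.
apply: (@cvg_roots_equivalent R u _ (Num.sqrt K)) ul => // t.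
- by rewrite divr_ge0 ?sqrtr_ge0.
- rewrite /u mulrCA; apply: ler_pM; rewrite ?invr_ge0 ?sqrtr_ge0 //.
    exact: norm2_le_wnorm.
  by rewrite ler_pdivlMr // mulrC ler_pdivrMr.
- rewrite /u mulrA; apply: ler_pM; rewrite ?invr_ge0 ?sqrtr_ge0 //.
  by rewrite lef_pV2 ?posrE // norm2_le_wnorm.
Qed.

Lemma exists_non_consensus : (1 < n)%N -> exists x : 'cV[R]_n, ~ consensus x.
Proof.
move=> n_gt1; pose i0 := Ordinal n_gt0; pose i1 := Ordinal n_gt1.
exists (\col_i (i == i0)%:R) => -[c /colP xc].
have := xc i1; have := xc i0; rewrite !mxE /= => <- /eqP.
by rewrite eq_sym oner_eq0.
Qed.

Lemma contracting_rate : self_adjoint w A -> (1 < n)%N ->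
  exists2 rho, is_convergence_rate A rho & rho <= q.
Proof.
move=> sA n_gt1.
have rates_nonempty : asymptotic_rates A !=set0.
  have [x nx] := exists_non_consensus n_gt1.
  by exists (limn (root_ratio A x)), x.
have rates_le : ubound (asymptotic_rates A) q.
  move=> _ [x nx <-]; have [l xl lq] := contracting_root_ratio sA nx.
  by rewrite (cvg_lim _ xl).
exists (sup (asymptotic_rates A)); last exact: ge_sup.
split => //.
- exact: contracting_consensus.
- by move=> x0 /(contracting_root_ratio sA)[l /cvgP].
- by split => //; exists q.
Qed.

(** The factor [sqrt (\sum_i w i)] pays for the passage from the maximum norm
    to the [w]-norm in which the contraction holds. *)
Lemma contracting_settled eps tau :
  q ^+ tau * Num.sqrt (\sum_i w i) <= eps -> settled_from A eps tau.
Proof.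
move=> htau t x0 tt nc; rewrite contracting_limit trajectoryB_const //.
have yN0 := deviation_neq0 nc.
have ymean := wdot_centered x0 n_gt0 w0.
move: (x0 - _) yN0 ymean => y yN0 ymean.
rewrite ler_pdivrMr ?normr_gt0 //.
apply: le_trans (norm_le_wnorm _ w1) _; apply: le_trans (contrA t ymean) _.
apply: (@le_trans _ _ (q ^+ tau * wnorm w y)).
  by apply: ler_wpM2r; rewrite ?sqrtr_ge0 // ler_wiXn2l // ltW.
apply: (@le_trans _ _ (q ^+ tau * (Num.sqrt (\sum_i w i) * `|y|))).
  by rewrite ler_wpM2l ?exprn_ge0 ?wnorm_le_norm.
by rewrite mulrA ler_wpM2r.
Qed.

End Contracting.

(** * Convergence time *)

(** After [m] steps [q ^ m <= (eps / n)^2], and the norm comparison costs at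
    most [sqrt W <= sqrt (3 n) <= n^2]. *)
Lemma mixing_time_bound (R : realType) (n : nat) (W eps : R) (m : nat) :
  (1 < n)%N -> W <= 3 * n%:R -> 0 < eps -> eps < 1 ->
  6 * n%:R ^+ 2 * ln (n%:R / eps) <= m%:R ->
  (1 - 1 / (3 * n%:R ^+ 2)) ^+ m * Num.sqrt W <= eps.
Proof.
move=> n_gt1 W3 e0 e1 hm.
have n2 : 2 <= n%:R :> R by rewrite (ler_nat R 2).
have n0 : 0 < n%:R :> R by lra.
have sqrtW : Num.sqrt W <= n%:R ^+ 2.
  rewrite -[leRHS]ger0_norm ?sqr_ge0 // -sqrtr_sqr; apply: ler_wsqrtr.
  apply: le_trans W3 _; rewrite -exprM exprS mulrC ler_pM2l //.
  by apply: (@le_trans _ _ (2 ^+ 3)); [lra | rewrite lerXn2r ?nnegrE // ltW].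
pose y := n%:R / eps.
have y0 : 0 < y by rewrite divr_gt0.
pose d : R := (3 * n%:R ^+ 2)^-1; rewrite div1r -/d.
have d0 : 0 < d by rewrite invr_gt0 mulr_gt0 // exprn_gt0.
have d1 : d <= 1.
  rewrite invf_le1 ?mulr_gt0 ?exprn_gt0 //; rewrite expr2; nra.
have decay : (1 - d) ^+ m <= y ^- 2.
  apply: (@le_trans _ _ (expR (- d) ^+ m)).
    rewrite lerXn2r ?nnegrE ?expR_ge0 ?subr_ge0 //; exact: expR_ge1Dx.
  rewrite -expRM_natl -[y]lnK ?posrE // -expRM_natl -expRN ler_expR.
  rewrite mulrN lerN2.
  have : 2 * ln y = d * (6 * n%:R ^+ 2 * ln y).
    by rewrite /d; field; rewrite gt_eqF.
  by move=> ->; rewrite mulrC ler_pM2r.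
apply: (@le_trans _ _ (y ^- 2 * n%:R ^+ 2)).
  by apply: ler_pM => //; rewrite ?exprn_ge0 ?subr_ge0 ?sqrtr_ge0.
rewrite /y expr_div_n invf_div mulfVK ?expf_neq0 ?gt_eqF //.
by rewrite expr2 ler_piMl ?ltW.
Qed.

(** The least settling time exists as soon as one settling time is known;
    rounding up to an integer costs one step, absorbed because
    [n^2 log2 (n / eps) >= 1]. *)
Lemma convergence_time_bound (R : realType) (n : nat) (eps : R) (A : 'M[R]_n)
    (settle : forall m : nat,
       6 * n%:R ^+ 2 * ln (n%:R / eps) <= m%:R -> settled_from A eps m) :
  (1 < n)%N -> reaches_consensus A -> 0 < eps -> eps < 1 ->
  exists2 T : nat, is_convergence_time A eps T &
    T%:R <= 7 * n%:R ^+ 2 * log2 (n%:R / eps).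
Proof.
move=> n_gt1 consA e0 e1.
have n2 : 2 <= n%:R :> R by rewrite (ler_nat R 2).
have y2 : 2 <= n%:R / eps.
  by rewrite ler_pdivlMr //; nra.
move: (n%:R / eps) y2 settle => y y2 settle.
have ln2 : 0 < ln 2 :> R by rewrite ln_gt0 // ltr1n.
have ln21 : ln 2 <= 1 :> R.
  by have := @le_ln1Dx R 1; rewrite (_ : 1 + 1 = 2) //; apply; lra.
have lny : ln 2 <= ln y by rewrite ler_ln ?posrE //; lra.
have log1 : 1 <= log2 y by rewrite /log2 ler_pdivlMr // mul1r.
have lnlog : ln y <= log2 y by rewrite /log2 ler_pdivlMr // ler_piMr //; lra.
pose X := 6 * n%:R ^+ 2 * ln y.
have X0 : 0 <= X by rewrite !mulr_ge0 ?sqr_ge0 //; lra.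
have /andP[Xge Xlt] := Num.Theory.truncn_itv X0.
have settle0 := settle _ (ltW Xlt).
have exT : exists m, `[< settled_from A eps m >].
  by exists (Num.truncn X).+1; apply/asboolP.
case: (ex_minnP exT) => T /asboolP setT minT.
exists T; first by split=> // m hm; apply: minT; apply/asboolP.
have : (T <= (Num.truncn X).+1)%N by apply: minT; apply/asboolP.
rewrite -(ler_nat R) -natr1 => hT; apply: le_trans hT _.
apply: (@le_trans _ _ (X + 1)); first by rewrite lerD2r.
have n1 : 1 <= n%:R ^+ 2 :> R by rewrite expr2; nra.
have : 6 * n%:R ^+ 2 * ln y <= 6 * n%:R ^+ 2 * log2 y.
  by apply: ler_wpM2l => //; lra.
have : 1 <= n%:R ^+ 2 * log2 y by nra.
rewrite /X; lra.
Qed.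

Theorem theorem6p2 (R : realType) :
  exists (c : R) (n0 : nat), 0 < c /\
    forall (n : nat) (e : rel 'I_n),
      (2 <= n)%N -> bidirectional_spanning_tree e ->
      (exists2 rho : R,
         is_convergence_rate (equal_neighbor_mx R e) rho &
         rho <= 1 - 1 / (3 * n%:R ^+ 2)) /\
      ((n0 <= n)%N -> forall eps : R, 0 < eps -> eps < 1 ->
         exists2 T : nat,
           is_convergence_time (equal_neighbor_mx R e) eps T &
           T%:R <= c * n%:R ^+ 2 * log2 (n%:R / eps)).
Proof.
exists 7, 0%N; split => // n e n_gt1 tree.
have n_gt0 : (0 < n)%N by exact: ltnW.
have sparse := tree_sum_degrees tree.
have [sym_e refl_e [conn_d _]] := tree.
have conn_e i j : connect e i j.
  by apply: connect_sub (conn_d i j) => k l /andP[_ /connect1].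
have n2 : 2 <= n%:R :> R by rewrite (ler_nat R 2).
have gap_gt0 : 0 < 1 / (3 * n%:R ^+ 2) :> R.
  by rewrite divr_gt0 // mulr_gt0 // exprn_gt0 //; lra.
have gap_lt1 : 1 / (3 * n%:R ^+ 2) < 1 :> R.
  by rewrite ltr_pdivrMr ?mul1r ?mulr_gt0 ?exprn_gt0 // ?expr2; nra.
have q_gt0 : 0 < 1 - 1 / (3 * n%:R ^+ 2) :> R by lra.
have q_lt1 : 1 - 1 / (3 * n%:R ^+ 2) < 1 :> R by lra.
have d1 i := degree_ge1 R i refl_e.
have d0 i := degree_gt0 R i refl_e.
have sA := @equal_neighbor_self_adjoint R _ _ sym_e refl_e.
have A_const c := equal_neighbor_const (c : R) refl_e.
have contr : contracts (degree R e) (equal_neighbor_mx R e) (1 - 1 / (3 * n%:R ^+ 2)).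
  move=> y t y0; apply: trajectory_contraction y0 => // x x0.
  exact: equal_neighbor_numerical_radius.
split; first exact: contracting_rate n_gt0 d1 A_const (ltW q_gt0) q_lt1 contr sA n_gt1.
move=> _ eps e0 e1; apply: convergence_time_bound => // [m hm|].
  apply: (contracting_settled n_gt0 d1 A_const (ltW q_gt0) q_lt1 contr).
  apply: mixing_time_bound => //.
  by rewrite -natr_sum -natrM ler_nat.
exact: contracting_consensus n_gt0 d1 A_const (ltW q_gt0) q_lt1 contr.
Qed.
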